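(* Let $n\ge1$ and let $\mu=(\mu_1,\dots,\mu_n)\in\mathbb{Z}_{\ge0}^n$ be a weak composition. Then the non-symmetric Macdonald polynomial $E_\mu$ (for generic $q,t$) has the same support as the polynomial $$\sum_{f\in C_n(G,c)}x^f,$$ where $G=G_{\mathcal{F}(\mu)}$ is the Dyck graph of the Dyckification of $\mu$ and $c$ is the coloring of the basement vertices given by $c(i,0)=i$ for $1\le i\le n$ (that is, $c(i)=i$ on the vertices $1,\dots,n$ of $G$).
   Context: **Diagrams and fillings.** For $\mu\in\mathbb{Z}_{\ge0}^n$ let $dg'(\mu)=\{(i,j):1\le i\le n,\ 1\le j\le\mu_i\}$ ($i$ column, $j$ row) and $\widehat{dg}(\mu)=dg'(\mu)\cup\{(i,0):1\le i\le n\}$; the boxes $(i,0)$ form the basement. A filling is a map $\sigma:dg'(\mu)\to\{1,\dots,n\}$; $\widehat\sigma$ extends $\sigma$ by $\widehat\sigma(i,0)=i$. Two distinct boxes attack each other if they are in the same row, or they are in consecutive rows and the box in the lower row is in a column strictly to the right of that of the box in the upper row. $\sigma$ is non-attacking if $\widehat\sigma(u)\ne\widehat\sigma(v)$ for all attacking $u,v\in\widehat{dg}(\mu)$. Put $x^\sigma=\prod_{u\in dg'(\mu)}x_{\sigma(u)}$. **Non-symmetric Macdonald polynomials.** For $u=(i,j)\in dg'(\mu)$ let $d(u)=(i,j-1)$, $l(u)=\mu_i-j$, $a(u)=\#\{(i',j)\in dg'(\mu):i'<i,\ \mu_{i'}\le\mu_i\}+\#\{(i',j-1)\in\widehat{dg}(\mu):i'>i,\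 \mu_{i'}<\mu_i\}$. Let $\mathrm{Des}(\widehat\sigma)=\{u\in dg'(\mu):\widehat\sigma(u)>\widehat\sigma(d(u))\}$; $\mathrm{Inv}(\widehat\sigma)$ is the set of attacking pairs $u,v\in\widehat{dg}(\mu)$ with $u$ before $v$ in reading order (rows top to bottom, right to left in each row) and $\widehat\sigma(u)>\widehat\sigma(v)$. Set $\mathrm{maj}(\widehat\sigma)=\sum_{u\in\mathrm{Des}(\widehat\sigma)}(l(u)+1)$, $\mathrm{inv}(\widehat\sigma)=|\mathrm{Inv}(\widehat\sigma)|-|\{i<j:\mu_i\le\mu_j\}|-\sum_{u\in\mathrm{Des}(\widehat\sigma)}a(u)$, $\mathrm{coinv}(\widehat\sigma)=\sum_{u\in dg'(\mu)}a(u)-\mathrm{inv}(\widehat\sigma)$, and $$E_\mu=\sum_{\sigma\ \text{non-attacking}}x^\sigma q^{\mathrm{maj}(\widehat\sigma)}t^{\mathrm{coinv}(\widehat\sigma)}\prod_{u\in dg'(\mu),\ \widehat\sigma(u)\ne\widehat\sigma(d(u))}\frac{1-t}{1-q^{l(u)+1}t^{a(u)+1}}.$$ ''Generic $q,t$'': $q,t$ are indeterminates (any real $0<q,t<1$ may be used instead). The support of a polynomial is the set of exponent vectors with nonzero coefficient. **Dyck graphs and Dyckification.** A Dyck path $\delta$ of length $M$ is a lattice path from $(0,0)$ to $(M,M)$ with unit north ($N$) and east ($E$) steps staying weakly above $y=x$. The Dyck graph $G_\delta$ has vertex set $[M]$, with $i<j$ adjacent iff $(i-1,j)$ lies on or below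 $\delta$. Label each box of $\widehat{dg}(\mu)$ by $EN$ if there is a box directly above it and by $E$ otherwise; $\mathcal{F}(\mu)$ is the Dyck path given by $n$ north steps followed by the labels read row by row from bottom to top, left to right in each row. Its length is $|\mu|+n$. The vertices $1,\dots,|\mu|+n$ of $G_{\mathcal{F}(\mu)}$ are identified with the boxes of $\widehat{dg}(\mu)$ in this same order, so vertices $1,\dots,n$ are the basement boxes $(1,0),\dots,(n,0)$. **Colorings.** For a graph $G=(V,E)$ and a proper coloring $c:V'\to[n]$ of an induced subgraph on $V'\subseteq V$, $C_n(G,c)$ is the set of proper colorings $f:V\to[n]$ of $G$ with $f|_{V'}=c$, and for such $f$ the monomial is $x^f=\prod_{v\in V\setminus V'}x_{f(v)}$. *)

(* Defs.v *)
From HB Require Import structures.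
From mathcomp Require Import all_boot all_order all_algebra.
From mathcomp Require Import mpoly zify.

Set Implicit Arguments.
Unset Strict Implicit.
Unset Printing Implicit Defensive.

Import GRing.Theory.
Local Open Scope nat_scope.

(* Columns and colors 1, ..., n are represented by 'I_n (shifted by one).
   Rows are not shifted: row 0 is the basement. *)

Section Diagrams.
Variables (n : nat) (mu : 'I_n -> nat).

(* The augmented diagram: column i has rows 0, ..., mu i. *)
Definition adiag := {i : 'I_n & 'I_(mu i).+1}.

Definition box_col (u : adiag) : 'I_n := tag u.
Definition box_row (u : adiag) : nat := tagged u.

Definition diag := {u : adiag | 0 < box_row u}.

(* [inord] is never out of range here; only meaningful when [0 < box_row u]. *)
Definition below (u : adiag) : adiag :=
  Tagged (fun i => 'I_(mu i).+1) (inord (box_row u).-1 : 'I_(mu (tag u)).+1).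

Definition filling := {ffun diag -> 'I_n}.

Definition augment (s : filling) (u : adiag) : 'I_n :=
  if insub u is Some v then s v else box_col u.

Definition attack (u v : adiag) : bool :=
  (u != v) &&
  [|| box_row u == box_row v,
      (box_row u == (box_row v).+1) && (box_col u < box_col v)
    | (box_row v == (box_row u).+1) && (box_col v < box_col u)].

Definition nonattacking (s : filling) : bool :=
  [forall u, forall v, attack u v ==> (augment s u != augment s v)].

Definition leg (u : diag) : nat := mu (box_col (val u)) - box_row (val u).

Definition arm (u : diag) : nat :=
  #|[set v : diag | [&& box_row (val v) == box_row (val u),
                        box_col (val v) < box_col (val u)
                      & mu (box_col (val v)) <= mu (box_col (val u))]]|
  + #|[set v : adiag | [&& (box_row v).+1 == box_row (val u),
                           box_col (val u) < box_col v
                         & mu (box_col v) < mu (box_col (val u))]]|.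

Definition Des (s : filling) : {set diag} :=
  [set u | augment s (below (val u)) < augment s (val u)].

(* Rows from top to bottom, right to left within a row. *)
Definition reads_before (u v : adiag) : bool :=
  (box_row v < box_row u)
  || (box_row u == box_row v) && (box_col v < box_col u).

Definition Inv (s : filling) : {set adiag * adiag} :=
  [set p | [&& attack p.1 p.2, reads_before p.1 p.2
             & augment s p.2 < augment s p.1]].

Definition maj (s : filling) : nat := \sum_(u in Des s) (leg u).+1.

Definition inv_stat (s : filling) : int :=
  (#|Inv s|%:Z
   - #|[set p : 'I_n * 'I_n | (p.1 < p.2)%N && (mu p.1 <= mu p.2)%N]|%:Z
   - (\sum_(u in Des s) arm u)%:Z)%R.

Definition coinv_stat (s : filling) : int := ((\sum_u arm u)%:Z - inv_stat s)%R.

End Diagrams.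

Section Macdonald.
Variables (K : fieldType) (q t : K) (n : nat) (mu : 'I_n -> nat).
Local Open Scope ring_scope.

Definition filling_weight (s : filling mu) : K :=
  q ^+ maj s * t ^ coinv_stat s *
  \prod_(u : diag mu | augment s (val u) != augment s (below (val u)))
     ((1 - t) / (1 - q ^+ (leg u).+1 * t ^+ (arm u).+1)).

Definition macdonaldE : {mpoly K[n]} :=
  \sum_(s : filling mu | nonattacking s)
     filling_weight s *: \prod_(u : diag mu) 'X_(s u).

End Macdonald.

Definition Qqt : fieldType := {fraction {mpoly rat[2]}}.
Definition qvar : Qqt := tofrac ('X_ord0 : {mpoly rat[2]}).
Definition tvar : Qqt := tofrac ('X_ord_max : {mpoly rat[2]}).

Inductive step := North | East.

Definition is_north (s : step) : bool := if s is North then true else false.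
Definition is_east (s : step) : bool := ~~ is_north s.

(* After its first m steps, the path d is at (abscissa d m, height d m). *)
Definition abscissa (d : seq step) (m : nat) : nat := count is_east (take m d).
Definition height (d : seq step) (m : nat) : nat := count is_north (take m d).

Definition is_dyck (M : nat) (d : seq step) : bool :=
  [&& count is_east d == M, count is_north d == M
    & [forall m : 'I_(size d).+1, abscissa d m <= height d m]].

Record dyck_path (M : nat) :=
  DyckPath { steps :> seq step; _ : is_dyck M steps }.

Definition on_or_below (d : seq step) (x y : nat) : bool :=
  [exists m : 'I_(size d).+1, (abscissa d m == x) && (y <= height d m)].

(* The vertex k of [M] is the ordinal k - 1, so that the point (i - 1, j) for
   vertices i < j of [M] becomes (u, v + 1) for u < v in 'I_M. *)
Definition dyck_graph (M : nat) (d : dyck_path M) : rel 'I_M :=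
  fun u v => ((u < v) && on_or_below d u v.+1)
          || ((v < u) && on_or_below d v u.+1).

Section Dyckification.
Variables (n : nat) (mu : 'I_n -> nat).

Definition box_le (u v : adiag mu) : bool :=
  (box_row u < box_row v)
  || (box_row u == box_row v) && (box_col u <= box_col v).

(* The k-th box of this list (from 0) is the box identified with the vertex
   k : 'I_(|mu| + n) of the Dyck graph of the Dyckification. *)
Definition boxes : seq (adiag mu) := sort box_le (enum {: adiag mu}).

Definition has_above (u : adiag mu) : bool := box_row u < mu (box_col u).

Definition label (u : adiag mu) : seq step :=
  if has_above u then [:: East; North] else [:: East].

Definition dyckification_steps : seq step :=
  nseq n North ++ flatten [seq label u | u <- boxes].

Lemma box_le_trans : transitive box_le.
Proof. by move=> v u w; rewrite /box_le; lia. Qed.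

Lemma box_le_total : total box_le.
Proof. by move=> u v; rewrite /box_le; lia. Qed.

Lemma box_eq (u v : adiag mu) :
  box_row u = box_row v -> box_col u = box_col v -> u = v.
Proof.
case: u => i j; case: v => k l; rewrite /box_row /box_col /= => + eik.
by move: j l; rewrite eik => j l /val_inj ->.
Qed.

Lemma box_le_anti : antisymmetric box_le.
Proof.
move=> u v; rewrite /box_le => uv.
by apply: box_eq; [lia | apply: val_inj => /=; lia].
Qed.

Lemma row_below (u : adiag mu) : box_row (below u) = (box_row u).-1.
Proof.
rewrite {1}/box_row /= inordK //.
by case: u => i j; rewrite /box_row /=; have := ltn_ord j; lia.
Qed.

Lemma row_le (u : adiag mu) : box_row u <= mu (box_col u).
Proof. exact: (ltn_ord (tagged u)). Qed.

Lemma col_below (u : adiag mu) : box_col (below u) = box_col u.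
Proof. by []. Qed.

Lemma mem_boxes (u : adiag mu) : u \in boxes.
Proof. by rewrite mem_sort mem_enum. Qed.

Lemma boxes_uniq : uniq boxes.
Proof. by rewrite sort_uniq enum_uniq. Qed.

Lemma boxes_sorted : sorted box_le boxes.
Proof. exact: sort_sorted box_le_total _. Qed.

Lemma boxes_prefix k : k < size boxes ->
  k < n + count has_above (take k boxes).
Proof.
move=> lt_k; have := boxes_sorted; have := boxes_uniq.
have all_in := mem_boxes.
case def_u: (drop k boxes) => [|u s2].
  by move: (congr1 size def_u); rewrite size_drop /=; lia.
have size_s1 : size (take k boxes) = k by rewrite size_takel // ltnW.
move: (cat_take_drop k boxes) all_in size_s1; rewrite def_u.
move: (take k boxes) => s1 <- all_in size_s1.
rewrite sorted_pairwise; last exact: box_le_trans.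
rewrite pairwise_cat cat_uniq /= => /and4P[uniq1 uniq12 us2 _].
case/and4P=> /allrelP s1_le _ /allP u_le _.
have in_s1 v : box_le v u -> v != u -> v \in s1.
  move=> le_vu neq_vu; have := all_in v.
  rewrite mem_cat in_cons (negPf neq_vu) /= => /orP[//|/u_le le_uv].
  by case/eqP: neq_vu; apply: box_le_anti; rewrite le_vu.
pose s := rcons s1 u.
have uniq_s : uniq s.
  by rewrite rcons_uniq uniq1 andbT; apply: contra uniq12 => us1; rewrite us1.
have s_le v : v \in s -> box_le v u.
  rewrite mem_rcons in_cons => /orP[/eqP->|vs1]; first by rewrite /box_le; lia.
  by apply: s1_le => //; rewrite mem_head.
have -> : (k < n + count has_above s1) = (size s <= n + count has_above s1).
  by rewrite size_rcons size_s1.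
rewrite -(count_predC (fun v : adiag mu => box_row v == 0) s) leq_add //.
  rewrite -size_filter -(size_map (@box_col n mu)) -[leqRHS]card_ord.
  rewrite -(card_uniqP _) ?max_card // map_inj_in_uniq ?filter_uniq // => v w.
  rewrite !mem_filter => /andP[/eqP v0 _] /andP[/eqP w0 _].
  by apply: box_eq; rewrite v0 w0.
rewrite -!size_filter -(size_map (@below n mu)).
apply: uniq_leq_size.
  rewrite map_inj_in_uniq ?filter_uniq // => v w.
  rewrite !mem_filter /= => /andP[v0 _] /andP[w0 _] eq_vw.
  apply: box_eq; last by rewrite -col_below eq_vw.
  by have := row_below v; rewrite eq_vw row_below; lia.
move=> _ /mapP[v + ->]; rewrite !mem_filter /= => /andP[v0 /s_le le_vu].
apply/andP; split.
  rewrite /has_above row_below col_below.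
  by have := row_le v; lia.
apply: in_s1; first by move: le_vu; rewrite /box_le row_below col_below; lia.
apply: contraTneq le_vu => <-; rewrite /box_le row_below; lia.
Qed.

Lemma labels_prefix (s : seq (adiag mu)) a :
    (forall k, k < size s -> k < a + count has_above (take k s)) ->
  forall m, abscissa (flatten [seq label u | u <- s]) m
         <= a + height (flatten [seq label u | u <- s]) m.
Proof.
rewrite /abscissa /height; elim: s a => [|u s IHs] a Hs m //=.
have a_gt0 : 0 < a by have := Hs 0 isT; rewrite take0 /=; lia.
have {}Hs k : k < size s -> k < a.-1 + has_above u + count has_above (take k s).
  by move=> lt_k; have := Hs k.+1; rewrite /= ltnS => /(_ lt_k); lia.
have {IHs} := IHs _ Hs; rewrite /label; case: (has_above u) => IHs.
  case: m => [|[|m]] //=; first last.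
    by have := IHs m; rewrite /is_east /=; lia.
  by rewrite /is_east; case: (flatten (map label s)) => /=; lia.
by case: m => [|m] //=; have := IHs m; rewrite /is_east /=; lia.
Qed.

Lemma size_boxes : size boxes = \sum_i mu i + n.
Proof.
rewrite size_sort -cardE card_tagged sumnE big_map big_enum /=.
under eq_bigr => i _ do rewrite card_ord -addn1.
by rewrite big_split /= sum1_card card_ord.
Qed.

Lemma count_has_above : count has_above boxes = \sum_i mu i.
Proof.
rewrite -sum1_count (perm_big (enum {: adiag mu})) ?perm_sort //= big_enum_cond.
rewrite big_mkcond /=.
pose F i (j : 'I_(mu i).+1) := if j < mu i then 1 else 0.
rewrite -(sig_big_dep (fun=> true) (fun _ _ => true) F).
apply: eq_bigr => i _; rewrite big_ord_recr /F /= ltnn addn0.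
by under eq_bigr => j _ do rewrite ltn_ord; rewrite sum1_card card_ord.
Qed.

Lemma dyckification_dyck : is_dyck (\sum_i mu i + n) dyckification_steps.
Proof.
have east s : count is_east (flatten [seq label u | u <- s]) = size s.
  by elim: s => //= u s IHs; rewrite count_cat IHs /label; case: has_above.
have north s : count is_north (flatten [seq label u | u <- s])
             = count has_above s.
  by elim: s => //= u s IHs; rewrite count_cat IHs /label; case: has_above.
apply/and3P; split.
- by rewrite count_cat count_nseq east size_boxes.
- by rewrite count_cat count_nseq north count_has_above mul1n addnC.
apply/forallP=> m; rewrite /abscissa /height /dyckification_steps.
rewrite take_cat size_nseq; case: ltnP => [lt_mn|_].
  by rewrite take_nseq ?(ltnW lt_mn) // !count_nseq.
rewrite !count_cat !count_nseq mul0n mul1n add0n.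
exact: labels_prefix boxes_prefix _.
Qed.

Definition dyckification : dyck_path (\sum_i mu i + n) :=
  DyckPath dyckification_dyck.

End Dyckification.

Section Colorings.
Variables (n : nat) (V : finType) (e : rel V) (V' : {pred V}).

Definition proper_coloring (f : {ffun V -> 'I_n}) : bool :=
  [forall u, forall v, e u v ==> (f u != f v)].

Definition extensions (c : {v : V | v \in V'} -> 'I_n) :
  {set {ffun V -> 'I_n}} :=
  [set f | proper_coloring f && [forall v, f (val v) == c v]].

Definition coloring_poly (c : {v : V | v \in V'} -> 'I_n) : {mpoly int[n]} :=
  (\sum_(f in extensions c) \prod_(v | v \notin V') 'X_(f v))%R.

End Colorings.

Definition basement (n M : nat) : {pred 'I_M} := fun v : 'I_M => v < n.
Arguments basement n M : clear implicits.

Definition basement_coloring (n M : nat) (v : {v : 'I_M | v \in basement n M}) :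
  'I_n := Ordinal (valP v : val v < n).
Arguments basement_coloring n M v : clear implicits.

(* Main.v *)
Require Import Defs.
From mathcomp Require Import all_boot all_order all_algebra.
From mathcomp Require Import mpoly.
From mathcomp Require Import zify.

(** The Dyck graph of the Dyckification is the attack graph of the augmented
    diagram: a vertex u is adjacent to the later vertex v exactly when v is
    among the first n + #{boxes before u having a box above} boxes, and these
    are the basement boxes together with the boxes lying above a box before u.
    Hence the colorings extending the basement coloring are the non-attacking
    fillings, with the same monomials. No cancellation occurs in E_mu, since
    every weight is a quotient of polynomials that are positive at
    q = t = 1/2. *)

Set Implicit Arguments.
Unset Strict Implicit.
Unset Printing Implicit Defensive.

Import Order.TTheory GRing.Theory Num.Theory.

(** * Supports of sums with positive coefficients *)

Section PositiveSupport.
Local Open Scope ring_scope.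
Variables (R : nzRingType) (pos : R -> Prop).
Hypothesis posD : forall x y, pos x -> pos y -> pos (x + y).
Hypothesis pos_neq0 : ~ pos 0.

(** The coefficient at [m] collects the weights of the indices with [e i = m], and a nonempty sum of
    positive elements is nonzero. Keeping [pos] abstract serves both [Qqt] and [int]. *)
Lemma msupp_pos_sum n (I : finType) (S : pred I) (w : I -> R)
    (e : I -> 'X_{1..n}) (m : 'X_{1..n}) :
    (forall i, S i -> pos (w i)) ->
  (m \in msupp (\sum_(i | S i) w i *: 'X_[e i])) = [exists i, S i && (e i == m)].
Proof.
move=> w_pos; rewrite mcoeff_msupp raddf_sum /=.
have -> : \sum_(i | S i) (w i *: 'X_[e i])@_m = \sum_(i | S i && (e i == m)) w i.
  rewrite big_mkcondr; apply: eq_bigr => i _.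
  by rewrite mcoeffZ mcoeffX; case: (e i == m); rewrite ?mulr1 ?mulr0.
apply/idP/existsP => [|[i0 Si0]].
  case: (pickP (fun i => S i && (e i == m))) => [i Si _|no_i]; first by exists i.
  by rewrite big_pred0 ?eqxx.
rewrite (bigD1 i0) //=; apply/eqP => sum0; apply: pos_neq0; rewrite -sum0.
(* The remaining sum may be empty, and [pos 0] fails, hence the disjunction. *)
have: \sum_(i | S i && (e i == m) && (i != i0)) w i = 0
      \/ pos (\sum_(i | S i && (e i == m) && (i != i0)) w i).
  apply: (big_ind (fun x => x = 0 \/ pos x)) => [|x y|i]; first by left.
    by case=> [->|px] [->|py]; rewrite ?add0r ?addr0; auto.
  by case/andP=> /andP[Si _] _; right; exact: w_pos.
have w0 : pos (w i0) by apply: w_pos; case/andP: Si0.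
by case=> [->|]; rewrite ?addr0 //; exact: posD.
Qed.

End PositiveSupport.

(** * Positivity of the weights, and the two supports *)

Section GenericPositivity.
Local Open Scope ring_scope.

Notation eval_half p := (p.@[fun=> 2^-1 : rat]).

(** A fraction may have a pole at the evaluation point, so positivity is asked of some pair of
    numerator and denominator. *)
Definition generic_pos (x : Qqt) : Prop :=
  exists p r : {mpoly rat[2]},
    [/\ x = tofrac p / tofrac r, 0 < eval_half p & 0 < eval_half r].

Lemma eval_half_neq0 (p : {mpoly rat[2]}) :
  0 < eval_half p -> tofrac p != 0.
Proof.
by move=> p_gt0; rewrite tofrac_eq0; apply: contraTneq p_gt0 => ->; rewrite meval0.
Qed.

Lemma generic_pos_tofrac (p : {mpoly rat[2]}) :
  0 < eval_half p -> generic_pos (tofrac p).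
Proof. by exists p, 1; rewrite tofrac1 divr1 meval1. Qed.

Lemma generic_posD x y : generic_pos x -> generic_pos y -> generic_pos (x + y).
Proof.
case=> [p [r [-> p0 r0]]] [p' [r' [-> p'0 r'0]]].
exists (p * r' + p' * r), (r * r').
rewrite addf_div ?eval_half_neq0 // -!tofracM -tofracD; split=> //.
  by rewrite mevalD !mevalM addr_gt0 ?mulr_gt0.
by rewrite mevalM mulr_gt0.
Qed.

Lemma generic_posM x y : generic_pos x -> generic_pos y -> generic_pos (x * y).
Proof.
case=> [p [r [-> p0 r0]]] [p' [r' [-> p'0 r'0]]].
exists (p * p'), (r * r').
by rewrite mulf_div -!tofracM !mevalM !mulr_gt0.
Qed.

Lemma generic_posV x : generic_pos x -> generic_pos x^-1.
Proof. by case=> [p [r [-> p0 r0]]]; exists r, p; rewrite invf_div. Qed.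

Lemma generic_pos_neq0 : ~ generic_pos 0.
Proof.
case=> [p [r [/esym/eqP + p0 r0]]].
by rewrite mulf_eq0 invr_eq0 !(negPf (eval_half_neq0 _)).
Qed.

Lemma generic_pos1 : generic_pos 1.
Proof. by rewrite -tofrac1; apply: generic_pos_tofrac; rewrite meval1. Qed.

Lemma generic_posX x k : generic_pos x -> generic_pos (x ^+ k).
Proof.
move=> x_pos; elim: k => [|k IHk]; first exact: generic_pos1.
by rewrite exprS; exact: generic_posM.
Qed.

(** [coinv_stat] is an integer, so [tvar] occurs with an exponent that is not known to be
    nonnegative. *)
Lemma generic_posXz x (k : int) : generic_pos x -> generic_pos (x ^ k).
Proof.
by case: k => k x_pos; last apply: generic_posV; exact: generic_posX.
Qed.

Lemma generic_pos_q : generic_pos qvar.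
Proof. by apply: generic_pos_tofrac; rewrite mevalXU. Qed.

Lemma generic_pos_t : generic_pos tvar.
Proof. by apply: generic_pos_tofrac; rewrite mevalXU. Qed.

(** The value at 1/2 is 1 - 2^-(k+l+1), where the exponent k+l+1 is at least 1. *)
Lemma generic_pos_1Bqt k l : generic_pos (1 - qvar ^+ k * tvar ^+ l.+1).
Proof.
rewrite -!tofracXn -tofracM -tofrac1 -tofracB; apply: generic_pos_tofrac.
rewrite mevalB mevalM !rmorphXn /= meval1 !mevalXU -exprD subr_gt0.
by rewrite addnS exprn_ilt1.
Qed.

Lemma filling_weight_pos n (mu : 'I_n -> nat) (s : filling mu) :
  generic_pos (filling_weight qvar tvar s).
Proof.
apply: generic_posM; first apply: generic_posM.
- exact: generic_posX generic_pos_q.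
- exact: generic_posXz generic_pos_t.
apply: big_ind => [|x y|u _]; [exact: generic_pos1 | exact: generic_posM |].
apply: generic_posM; last by apply: generic_posV; exact: generic_pos_1Bqt.
(* The numerator [1 - tvar] is the case [k = l = 0]. *)
by have := generic_pos_1Bqt 0 0; rewrite expr0 mul1r expr1.
Qed.

Lemma msupp_macdonaldE n (mu : 'I_n -> nat) (m : 'X_{1..n}) :
  (m \in msupp (macdonaldE qvar tvar mu))
  = [exists s : filling mu,
      nonattacking s && ((\sum_(u : diag mu) U_(s u))%MM == m)].
Proof.
rewrite -(msupp_pos_sum generic_posD generic_pos_neq0 (w := @filling_weight Qqt qvar tvar n mu)).
  congr (m \in msupp _); apply: eq_bigr => s _; congr (_ *: _).
  by rewrite mprodXE.
by move=> s _; exact: filling_weight_pos.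
Qed.

Lemma msupp_coloring_poly n (V : finType) (e : rel V) (V' : {pred V})
    (c : {v : V | v \in V'} -> 'I_n) (m : 'X_{1..n}) :
  (m \in msupp (coloring_poly e c))
  = [exists f, (f \in extensions e c)
               && ((\sum_(v | v \notin V') U_(f v))%MM == m)].
Proof.
rewrite -(@msupp_pos_sum int (fun x => 0 < x) _ _ _ _ _ (fun=> 1)) //.
- congr (m \in msupp _); apply: eq_bigr => f _.
  by rewrite mprodXE scale1r.
- by move=> x y; exact: addr_gt0.
Qed.

End GenericPositivity.

(** * Height of a path above a given abscissa *)

Section Paths.
Local Open Scope nat_scope.

(** The end of [d1] is the highest point of the path at its abscissa, because the next step goes
    east. *)
Lemma on_or_below_cat (d1 d2 : seq step) y :
  on_or_below (d1 ++ East :: d2) (count is_east d1) y = (y <= count is_north d1).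
Proof.
apply/existsP/idP => [[m /andP[/eqP abs_m /leq_trans]]|le_y].
  apply; move: abs_m; rewrite /abscissa /height take_cat.
  case: ltnP => [lt_m _|le_m].
    by rewrite -[X in _ <= count _ X](cat_take_drop m d1) count_cat leq_addr.
  rewrite !count_cat; case: (m - size d1) => [|k] /=; first by rewrite !addn0.
  by rewrite /is_east /=; lia.
have lt_d1 : size d1 < (size (d1 ++ East :: d2)).+1 by rewrite size_cat ltnS leq_addr.
exists (Ordinal lt_d1).
by rewrite /abscissa /height /= take_size_cat // eqxx.
Qed.

End Paths.

(** * The Dyck graph as attack graph *)

Section AttackGraph.
Local Open Scope nat_scope.
Variables (n : nat) (mu : 'I_n -> nat).

Notation M := (\sum_i mu i + n).
Implicit Types u v w : adiag mu.

Definition box_index u : nat := index u (boxes mu).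

Lemma box_index_lt u : box_index u < M.
Proof. by rewrite -size_boxes index_mem mem_boxes. Qed.

Definition box_vertex u : 'I_M := Ordinal (box_index_lt u).

Lemma box_vertex_inj : injective box_vertex.
Proof.
move=> u v /(congr1 val)/= eq_uv.
by rewrite -(nth_index u (mem_boxes u)) [index _ _]eq_uv nth_index ?mem_boxes.
Qed.

Lemma card_adiag : #|{: adiag mu}| = M.
Proof. by rewrite cardE -size_boxes size_sort. Qed.

Lemma box_vertex_bij : bijective box_vertex.
Proof. by apply: (inj_card_bij box_vertex_inj); rewrite card_ord card_adiag. Qed.

Lemma box_index_ltn u v : (box_index u < box_index v) = ~~ box_le v u.
Proof.
have lt_le x y : box_index x < box_index y -> box_le x y.
  by apply: (sorted_ltn_index (@box_le_trans n mu) (boxes_sorted mu));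
    rewrite ?mem_boxes.
apply/idP/idP => [lt_uv|nle_vu].
  apply/negP => le_vu; move: (lt_uv).
  by rewrite (@box_le_anti n mu u v) ?ltnn // le_vu lt_le.
rewrite ltn_neqAle leqNgt (contra (@lt_le _ _) nle_vu) andbT.
apply: contra nle_vu => /eqP eq_uv.
by rewrite (@box_vertex_inj v u) ?/box_le ?eqxx ?leqnn ?orbT //; exact: val_inj.
Qed.

Lemma card_before u : #|[set w | ~~ box_le u w]| = box_index u.
Proof.
have lt_u : box_index u < size (boxes mu) by rewrite index_mem mem_boxes.
transitivity #|take (box_index u) (boxes mu)|.
  apply: eq_card => w.
  by rewrite !inE -box_index_ltn in_take ?mem_boxes.
by rewrite (card_uniqP _) ?take_uniq ?boxes_uniq // size_takel // ltnW.
Qed.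

(** A set closed downwards for the total order [box_le] is an initial segment of [boxes], so its
    cardinality alone decides membership. *)
Lemma box_index_downset (A : {set adiag mu}) v :
    (forall w x, x \in A -> box_le w x -> w \in A) ->
  (box_index v < #|A|) = (v \in A).
Proof.
move=> downA; rewrite -card_before; apply/idP/idP => [|vA].
  apply: contraTT => vA; rewrite -leqNgt; apply: subset_leq_card.
  apply/subsetP=> w wA; rewrite inE.
  by apply: contra vA; exact: downA.
apply: (@leq_trans #|v |: [set w | ~~ box_le v w]|).
  by rewrite cardsU1 inE /box_le eqxx leqnn orbT.
apply: subset_leq_card; apply/subsetP=> w.
rewrite !inE => /orP[/eqP->//|lt_wv]; apply: downA vA _.
by have := box_le_total v w; rewrite (negPf lt_wv).
Qed.

Definition basement_box (i : 'I_n) : adiag mu :=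
  Tagged (fun i => 'I_(mu i).+1) (ord0 : 'I_(mu i).+1).

Lemma row0_basement_box u : box_row u = 0 -> u = basement_box (box_col u).
Proof. by move=> u0; apply: box_eq. Qed.

(** The case [k = n] counts the whole basement; the case [k = i] counts the boxes preceding the
    basement box of column [i]. *)
Lemma card_basement_lt k : k <= n ->
  #|[set w : adiag mu | (box_row w == 0) && (box_col w < k)]| = k.
Proof.
move=> le_kn; rewrite -[RHS](card_ord k) -[RHS]sum1_card (big_ord_widen n (fun=> 1)) //=.
rewrite sum1dep_card -(card_imset _ (f := basement_box)); last first.
  by move=> i j /(congr1 (@box_col n mu)).
apply: eq_card => w; rewrite !inE; apply/andP/imsetP => [[/eqP w0 w_k]|[i]].
  by exists (box_col w); rewrite ?inE //; exact: row0_basement_box.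
by rewrite inE => i_k ->.
Qed.

(** This is what makes [basement_coloring] give each basement box its own column as color. *)
Lemma box_index_basement i : box_index (basement_box i) = i.
Proof.
rewrite -card_before -[RHS](card_basement_lt (ltnW (ltn_ord i))).
apply: eq_card => w; rewrite !inE /box_le /=; rewrite /box_row /box_col /=.
lia.
Qed.

Lemma box_index_lt_n u : (box_index u < n) = (box_row u == 0).
Proof.
rewrite -[X in _ < X](card_basement_lt (leqnn n)) box_index_downset.
  by rewrite inE ltn_ord andbT.
by move=> w x; rewrite !inE !ltn_ord !andbT /box_le => /eqP->; lia.
Qed.

(* The vertices lying under the path at the abscissa of [u]. *)
Definition reach u : {set adiag mu} :=
  [set v | (box_row v == 0) || ~~ box_le u (below v)].

(** The basement contributes [n], and [below] maps the rest of [reach u] bijectively onto the boxes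
    before [u] that have a box above. *)
Lemma card_reach u :
  #|reach u| = n + count (@has_above n mu) (take (box_index u) (boxes mu)).
Proof.
rewrite -[X in X + _](card_basement_lt (leqnn n)).
rewrite -(cardsID [set v : adiag mu | box_row v == 0] (reach u)).
congr (_ + _).
  by apply: eq_card => w; rewrite !inE ltn_ord; case: (_ == 0); rewrite ?andbF.
rewrite -size_filter -(card_uniqP _) ?filter_uniq ?take_uniq ?boxes_uniq //.
rewrite -(card_in_imset (f := @below n mu)); last first.
  move=> v w; rewrite !inE => /andP[v0 _] /andP[w0 _] eq_vw.
  apply: box_eq; last by rewrite -col_below eq_vw.
  by have := row_below v; rewrite eq_vw row_below; lia.
apply: eq_card => w; rewrite mem_filter in_take ?mem_boxes // box_index_ltn.
apply/imsetP/andP => [[v + ->]|[w_above lt_wu]].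
  rewrite !inE => /andP[v0]; rewrite (negPf v0) /= => ->; split=> //.
  by rewrite /has_above row_below col_below; have := row_le v; lia.
(* The box directly above [w] is its preimage under [below]. *)
pose v : adiag mu := Tagged (fun i => 'I_(mu i).+1)
  (Ordinal (w_above : (box_row w).+1 < (mu (box_col w)).+1)).
have vw : w = below v by apply: box_eq; rewrite ?row_below.
by exists v; rewrite // !inE -vw.
Qed.

(** Just before the East step of [u], the path has height [#|reach u|]. Since [reach u] is an
    initial segment, the boxes whose index is below this height are its elements. *)
Lemma on_or_below_dyckification u v :
  on_or_below (dyckification mu) (box_index u) (box_index v).+1
  = (v \in reach u).
Proof.
have lt_u : box_index u < size (boxes mu) by rewrite index_mem mem_boxes.
(* The part of the path preceding the East step that labels [u]. *)
pose d1 := nseq n North ++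
  flatten [seq label w | w <- take (box_index u) (boxes mu)].
rewrite -[steps _]/(dyckification_steps mu).
have [d2 ->] : exists d2, dyckification_steps mu = d1 ++ East :: d2.
  rewrite /dyckification_steps -(cat_take_drop (box_index u) (boxes mu)).
  rewrite (drop_nth u lt_u) nth_index ?mem_boxes // map_cat flatten_cat /= catA.
  by rewrite {2}/label; case: has_above; eexists.
have east s : count is_east (flatten [seq label w | w : adiag mu <- s]) = size s.
  by elim: s => //= w s IHs; rewrite count_cat IHs /label; case: has_above.
have north s : count is_north (flatten [seq label w | w : adiag mu <- s])
             = count (@has_above n mu) s.
  by elim: s => //= w s IHs; rewrite count_cat IHs /label; case: has_above.
have {1}-> : box_index u = count is_east d1.
  by rewrite count_cat count_nseq east size_takel // ltnW.
rewrite on_or_below_cat count_cat count_nseq north mul1n -card_reach.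
apply: box_index_downset => w x.
rewrite !inE /box_le !row_below !col_below; lia.
Qed.

(** For [u] before [v], [v] lies in [reach u] iff it is in the row of [u], or in the next row and
    strictly to the left. *)
Lemma dyck_graph_attack u v :
  dyck_graph (dyckification mu) (box_vertex u) (box_vertex v) = attack u v.
Proof.
rewrite /dyck_graph /= !on_or_below_dyckification !box_index_ltn !inE /attack.
have -> : (u != v) = ((box_row u != box_row v) || (box_col u != box_col v)).
  case: (eqVneq u v) => [->|neq_uv]; first by rewrite !eqxx.
  apply/esym; rewrite -negb_and; apply: contra neq_uv => /andP[/eqP rE /eqP cE].
  by apply/eqP/box_eq.
rewrite /box_le !row_below !col_below -(inj_eq val_inj) /=.
have := row_below u; lia.
Qed.

(** * Non-attacking fillings and proper colorings *)

Section Correspondence.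
Variables (s : filling mu) (f : {ffun 'I_M -> 'I_n}).
Hypothesis f_augment : forall u, f (box_vertex u) = augment s u.

Lemma nonattacking_extension : nonattacking s ->
  f \in extensions (dyck_graph (dyckification mu)) (basement_coloring n M).
Proof.
have [g gK Kg] := box_vertex_bij.
move=> /forallP s_na; rewrite inE; apply/andP; split.
  apply/forallP=> x; apply/forallP=> y.
  rewrite -(Kg x) -(Kg y) dyck_graph_attack !f_augment.
  exact: (forallP (s_na _)).
apply/forallP=> -[x x_base] /=; apply/eqP/val_inj => /=.
rewrite -(Kg x) f_augment; move: x_base; rewrite -{1}(Kg x).
rewrite unfold_in /= box_index_lt_n => /eqP x0.
rewrite /augment insubF ?x0 //.
by rewrite [in RHS](row0_basement_box x0) box_index_basement.
Qed.

Lemma extension_nonattacking :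
    f \in extensions (dyck_graph (dyckification mu)) (basement_coloring n M) ->
  nonattacking s.
Proof.
rewrite inE => /andP[/forallP f_proper _].
apply/forallP=> u; apply/forallP=> v.
rewrite -dyck_graph_attack -!f_augment; exact: (forallP (f_proper _)).
Qed.

(** The non-basement vertices are the boxes of positive row. Used with sums of exponent vectors, it
    equates the monomials of [f] and [s]. *)
Lemma big_diag_vertices (T : Type) (idx : T) (op : Monoid.com_law idx)
    (F : 'I_n -> T) :
  \big[op/idx]_(x : 'I_M | x \notin basement n M) F (f x)
  = \big[op/idx]_(u : diag mu) F (s u).
Proof.
rewrite (reindex box_vertex); last exact/onW_bij/box_vertex_bij.
rewrite (reindex_omap (val : diag mu -> adiag mu) insub); last first.
  move=> u; rewrite unfold_in /= box_index_lt_n -lt0n => u0.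
  by rewrite insubT.
apply: eq_big => [u|u _].
  by rewrite unfold_in /= box_index_lt_n -lt0n (valP u) valK eqxx.
by rewrite f_augment /augment valK.
Qed.

End Correspondence.

End AttackGraph.

Theorem corollary3p5 (n : nat) (mu : 'I_n -> nat) (n_gt0 : (0 < n)%N) :
  msupp (macdonaldE qvar tvar mu)
    =i msupp (coloring_poly (dyck_graph (dyckification mu))
                (basement_coloring n (\sum_i mu i + n)%N)).
Proof.
move=> m; rewrite msupp_macdonaldE msupp_coloring_poly.
apply/existsP/existsP => [[s /andP[s_na s_m]]|[f /andP[f_ext f_m]]].
  have [g gK _] := box_vertex_bij mu.
  pose f : {ffun _ -> 'I_n} := [ffun x => augment s (g x)].
  have f_s u : f (box_vertex u) = augment s u by rewrite ffunE gK.
  exists f; rewrite (nonattacking_extension f_s) //=.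
  by rewrite (big_diag_vertices f_s _ (fun i => U_(i)%MM)).
pose s : filling mu := [ffun u => f (box_vertex (val u))].
have f_s u : f (box_vertex u) = augment s u.
  rewrite /augment; case: insubP => [v _ <-|]; first by rewrite ffunE.
  (* On the basement, [augment] returns the column, which is also the color prescribed to the
     extension [f]. *)
  rewrite -eqn0Ngt => /eqP u0; have := f_ext.
  have u_base : box_vertex u \in basement n (\sum_i mu i + n)%N.
    by rewrite unfold_in /= box_index_lt_n u0.
  rewrite inE => /andP[_ /forallP/(_ (exist (fun x => x \in basement n _) _ u_base))/eqP /= ->].
  apply: val_inj => /=.
  by rewrite [in LHS](row0_basement_box u0) box_index_basement.
exists s; rewrite (extension_nonattacking f_s) //=.
by rewrite -(big_diag_vertices f_s _ (fun i => U_(i)%MM)).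
Qed.
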